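(* Let $X$ be a set, let $\mathcal{A}$ be an algebra of subsets of $X$, and let $m\colon\mathcal{A}\to[0,\infty]$ be a measure on $\mathcal{A}$, with corresponding outer measure $m^*$. Let $$\mathcal{M}:=\{E\subseteq X\colon \forall A\in\mathcal{A}_{\mathsf{fin}}\ \forall\varepsilon>0\ \exists B\in\mathcal{A}\ \ d_A(E,B)<\varepsilon\},$$ which is a $\sigma$-algebra over $X$. Then $m^*$ is $\sigma$-additive on $\mathcal{M}$; that is, $m^*\big(\bigcup_n E_n\big)=\sum_n m^*(E_n)$ for every sequence $(E_n)_{n=1}^\infty$ of pairwise disjoint sets in $\mathcal{M}$.
   Context: A measure on an algebra $\mathcal{A}$ over $X$ is a nonnegative function $m\colon\mathcal{A}\to[0,\infty]$ with $m(\emptyset)=0$ that is $\sigma$-additive: $m(\bigcup_n A_n)=\sum_n m(A_n)$ for every disjoint sequence $(A_n)$ in $\mathcal{A}$ with $\bigcup_n A_n\in\mathcal{A}$. Set $\mathcal{A}_{\mathsf{fin}}:=\{A\in\mathcal{A}\colon m(A)<\infty\}$. The outer measure corresponding to $m$ is defined for all $E\subseteq X$ by $m^*(E):=\inf\{\sum_{n=1}^\infty m(A_n)\colon (A_n)_{n=1}^\infty \text{ a sequence in }\mathcal{A},\ \bigcup_n A_n\supseteq E\}$. For $E,F\subseteq X$, $E+F$ denotes the symmetric difference of $E$ and $F$. For $A\in\mathcal{A}$ and $E,F\subseteq X$, $d_A(E,F):=m^*\big(A\cap(E+F)\big)$. *)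

(* Defs.v *)
From mathcomp Require Import all_boot all_order all_algebra.
From mathcomp Require Import all_classical all_reals all_analysis.

Set Implicit Arguments.
Unset Strict Implicit.
Unset Printing Implicit Defensive.

Import Order.TTheory GRing.Theory Num.Theory.

Local Open Scope classical_set_scope.
Local Open Scope ring_scope.
Local Open Scope ereal_scope.

(* The structures algebraOfSetsType and measure extend pointedType, so their
   carrier is never empty. To allow an arbitrary set X, the notions below are
   stated for a plain type; the lemmas at the end show that they coincide with
   the library ones on an algebraOfSetsType.
   Values of m outside the algebra AA are never used. *)

Definition is_algebra (X : Type) (AA : set (set X)) : Prop :=
  [/\ AA set0, setU_closed AA & setC_closed AA].

Definition is_measure_on (R : realType) (X : Type) (AA : set (set X))
    (m : set X -> \bar R) : Prop :=
  [/\ (forall A, AA A -> 0 <= m A),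
      m set0 = 0 &
      forall F : nat -> set X, (forall n, AA (F n)) -> trivIset setT F ->
        AA (\bigcup_n F n) -> m (\bigcup_n F n) = \sum_(n <oo) m (F n)].

Definition finite_part (R : realType) (X : Type) (AA : set (set X))
    (m : set X -> \bar R) : set (set X) :=
  [set A | AA A /\ m A < +oo].

Definition outer (R : realType) (X : Type) (AA : set (set X))
    (m : set X -> \bar R) (E : set X) : \bar R :=
  ereal_inf [set \sum_(n <oo) m (F n) |
    F in [set F : nat -> set X | (forall n, AA (F n)) /\
                                 E `<=` \bigcup_n F n]].

Definition dist_on (R : realType) (X : Type) (AA : set (set X))
    (m : set X -> \bar R) (A E F : set X) : \bar R :=
  outer AA m (A `&` (E `+` F)).

Definition approximable (R : realType) (X : Type) (AA : set (set X))
    (m : set X -> \bar R) : set (set X) :=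
  [set E | forall A, finite_part AA m A -> forall eps : R, (0 < eps)%R ->
     exists2 B, AA B & dist_on AA m A E B < eps%:E].

Lemma is_algebra_measurable (d : measure_display) (T : algebraOfSetsType d) :
  is_algebra (@measurable d T).
Proof.
split; [exact: measurable0|exact: measurableU|].
by move=> A; exact: measurableC.
Qed.

Lemma is_measure_on_measure (d : measure_display) (T : algebraOfSetsType d)
    (R : realType) (mu : {measure set T -> \bar R}) :
  is_measure_on (@measurable d T) mu.
Proof.
split=> [A _||F mF tF mUF]; [exact: measure_ge0|exact: measure0|].
exact: measure_semi_bigcup.
Qed.

Lemma outerE (d : measure_display) (T : algebraOfSetsType d)
    (R : realType) (mu : {measure set T -> \bar R}) :
  outer (@measurable d T) mu = mu_ext mu.
Proof. by []. Qed.

(* Main.v *)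
Require Import Defs.
From HB Require Import structures.
From mathcomp Require Import all_boot all_order all_algebra.
From mathcomp Require Import all_classical all_reals all_analysis.

(** The approximable sets are exactly the sets that are measurable in the sense
    of Caratheodory for the outer measure [mu] generated by [m]
    ([approximableE]); both claims are then Caratheodory's theorem.

    - Approximable sets are Caratheodory-measurable. Covering a test set of
      finite outer measure almost optimally by members of the algebra shows that
      it is enough to split the sets [A] of the algebra with [m A] finite
      ([caratheodory_finite_part]). On such an [A], an approximable [E] can be
      exchanged for a [B] of the algebra at a small cost, and [m] splits [A]
      along [B] by finite additivity ([approximable_caratheodory]).

    - Conversely, let [E] be Caratheodory-measurable and [m A] finite. Take a
      cover of [A `&` E] by members of the algebra that is almost optimal, and
      let [B] be the union of finitely many of its sets, so that the omitted
      ones have small total measure. Inside [A], the part of [E] missed by [B]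
      lies in the omitted sets; the part of [B] outside [E] lies in the cover
      but outside [A `&` E], and cutting along [E] shows that this surplus is at
      most the error of the cover ([caratheodory_approximable]). *)

Set Implicit Arguments.
Unset Strict Implicit.
Unset Printing Implicit Defensive.

Import Order.TTheory GRing.Theory Num.Theory.

Local Open Scope classical_set_scope.
Local Open Scope ring_scope.
Local Open Scope ereal_scope.

(** * Nonnegative series *)

Lemma nneseries_pair (R : realType) (e : nat -> nat * nat)
    (a : nat -> nat -> \bar R) :
  set_bij setT setT e -> (forall i j, 0 <= a i j) ->
  \sum_(n <oo) a (e n).1 (e n).2 = \sum_(i <oo) \sum_(j <oo) a i j.
Proof.
move=> e_bij a0.
rewrite (nneseries_esumT (fun n => a0 (e n).1 (e n).2)).
rewrite -(@reindex_esum _ _ _ _ _ e (fun k => a k.1 k.2) e_bij).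
rewrite nneseries_esumT; last by move=> i; exact: nneseries_ge0.
under [RHS]eq_esum do rewrite nneseries_esumT//.
by rewrite esum_esum//; congr (esum _ _); apply/seteqP; split.
Qed.

Lemma nneseries_bigcup2 (R : realType) (X : Type) (f : set X -> \bar R)
    (A B : set X) :
  f set0 = 0 -> 0 <= f A -> 0 <= f B ->
  \sum_(n <oo) f (bigcup2 A B n) = f A + f B.
Proof.
move=> f0 fA fB; rewrite (@nneseries_split _ _ 0 2); last first.
  by move=> [|[|k]] _ //=; rewrite /bigcup2/= f0.
rewrite eseries0 ?adde0; last by move=> [|[|k]].
by rewrite big_mkord !big_ord_recl big_ord0 adde0.
Qed.

(** * Caratheodory's theorem *)

Lemma caratheodory_sigma_algebra (R : realType) (X : Type)
    (mu : {outer_measure set X -> \bar R}) :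
  sigma_algebra setT mu.-caratheodory.
Proof.
split; first exact: caratheodory_measurable_set0.
- by move=> A; rewrite setTD; exact: caratheodory_measurable_setC.
- exact: caratheodory_measurable_bigcup.
Qed.

(** One bound is subadditivity; the other is Caratheodory's inequality for the
    sequence, tested on its own union, where the part outside is empty. *)
Lemma caratheodory_sigma_additive (R : realType) (X : Type)
    (mu : {outer_measure set X -> \bar R}) (E : nat -> set X) :
  (forall n, mu.-caratheodory (E n)) -> trivIset setT E ->
  mu (\bigcup_n E n) = \sum_(n <oo) mu (E n).
Proof.
move=> carE tE; apply/eqP; rewrite eq_le outer_measure_sigma_subadditive/=.
have := @caratheodory_lime_le _ _ mu _ carE tE (\bigcup_n E n).
rewrite setICr outer_measure0 adde0; congr (_ <= _).
apply: eq_eseriesr => n _; congr (mu _).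
by apply/setIidPr; exact: bigcup_sup.
Qed.

(** * The outer measure generated by a measure on an algebra *)

Section outer.
Context (R : realType) (X : Type) (AA : set (set X)) (m : set X -> \bar R).
Hypotheses (hAA : is_algebra AA) (hm : is_measure_on AA m).

Local Notation mu := (outer AA m).

Let AA0 : AA set0. Proof. by case: hAA. Qed.

Let AAU A B : AA A -> AA B -> AA (A `|` B).
Proof. by case: hAA => _ + _; apply. Qed.

Let AAC A : AA A -> AA (~` A). Proof. by case: hAA => _ _; apply. Qed.

Let m_ge0 A : AA A -> 0 <= m A. Proof. by case: hm => + _ _; apply. Qed.

Let m0 : m set0 = 0. Proof. by case: hm. Qed.

Let AAI A B : AA A -> AA B -> AA (A `&` B).
Proof.
move=> hA hB; rewrite -(setCK (A `&` B)) setCI.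
by apply/AAC/AAU; exact: AAC.
Qed.

Let AAD A B : AA A -> AA B -> AA (A `\` B).
Proof. by move=> hA hB; rewrite setDE; apply: AAI => //; exact: AAC. Qed.

(** Finite additivity is sigma-additivity along the sequence
    [A `&` B, A `\` B, set0, set0] and so on. *)
Let m_additive A B : AA A -> AA B -> m (A `&` B) + m (A `\` B) = m A.
Proof.
move=> hA hB; have hI := AAI hA hB; have hD := AAD hA hB.
rewrite -nneseries_bigcup2 ?m_ge0//.
have AE : \bigcup_n bigcup2 (A `&` B) (A `\` B) n = A.
  by rewrite bigcup2E setUIDK.
case: hm => _ _ <-; rewrite ?AE//.
- by move=> [|[|n]].
- apply/trivIsetP => -[|[|i]] [|[|j]] //= _ _ _; rewrite ?setI0 ?set0I//.
  + by rewrite setDE setIACA setICr setI0.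
  + by rewrite setDE setIACA setICl setI0.
Qed.

Lemma outer_le_series E (F : nat -> set X) :
  (forall n, AA (F n)) -> E `<=` \bigcup_n F n ->
  mu E <= \sum_(n <oo) m (F n).
Proof. by move=> hF EF; apply: ereal_inf_lbound; exists F. Qed.

Lemma outer_cover E (x : \bar R) : mu E < x ->
  exists F : nat -> set X, [/\ forall n, AA (F n), E `<=` \bigcup_n F n &
    \sum_(n <oo) m (F n) < x].
Proof. by move=> /ereal_inf_lt[_ [F [hF EF] <-] Fx]; exists F. Qed.

Lemma outer_ge0 E : 0 <= mu E.
Proof.
apply: le_ereal_inf_tmp => _ [F [hF _] <-].
by apply: nneseries_ge0 => n _ _; exact: m_ge0.
Qed.

Lemma le_outer E F : E `<=` F -> mu E <= mu F.
Proof.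
move=> EF; apply: ereal_inf_le_tmp => _ [G [hG FG] <-].
by exists G => //; split => //; exact: subset_trans FG.
Qed.

Lemma outer_le A : AA A -> mu A <= m A.
Proof.
move=> hA; rewrite -[leRHS]adde0 -m0 -nneseries_bigcup2 ?m_ge0//.
by apply: outer_le_series; [case=> [|[|n]]|rewrite bigcup2E setU0].
Qed.

Lemma outer0 : mu set0 = 0.
Proof. by apply/eqP; rewrite eq_le outer_ge0 andbT -m0 outer_le. Qed.

(** Almost optimal covers of the [E n], with errors forming a geometric series of
    sum [e], are merged into one cover along a bijection between [nat] and
    [nat * nat]. *)
Lemma outer_sigma_subadditive : sigma_subadditive mu.
Proof.
move=> E; have [[n Eoo]|Efin] := pselect (exists n, mu (E n) = +oo).
  rewrite (eseries_pinfty _ _ Eoo) ?leey// => k _.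
  by rewrite -ltNye (lt_le_trans _ (outer_ge0 _)).
apply/lee_addgt0Pr => e e0.
apply: le_trans (epsilon_trick xpredT (fun n => outer_ge0 (E n)) (ltW e0)).
have coverE n : exists F : nat -> set X, [/\ forall k, AA (F k),
    E n `<=` \bigcup_k F k &
    \sum_(k <oo) m (F k) < mu (E n) + (e / (2 ^ n.+1)%:R)%:E].
  apply: outer_cover; rewrite lteDl ?lte_fin ?divr_gt0 ?ltr0n ?expn_gt0//.
  rewrite ge0_fin_numE ?outer_ge0// ltey; apply/eqP => Enoo.
  by apply: Efin; exists n.
have [F hF] := choice coverE.
have AAF i j : AA (F i j) by case: (hF i).
have /card_esym/ppcard_eqP[f] := card_nat2.
apply: (@le_trans _ _ (\sum_(n <oo) m (F (f n).1 (f n).2))).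
  apply: outer_le_series => // x [n _ Enx].
  have [_ EF _] := hF n; have [k _ Fx] := EF x Enx.
  have [i _ fi] := @surj _ _ _ _ f (n, k) I.
  by exists i => //; rewrite fi.
rewrite (@nneseries_pair _ f (fun i j => m (F i j)))//; last first.
  by move=> i j; exact: m_ge0.
apply: lee_nneseries => n *; last by apply/ltW; case: (hF n).
by apply: nneseries_ge0 => k _ _; exact: m_ge0.
Qed.

#[local] HB.instance Definition _ := isOuterMeasure.Build R X mu
  outer0 outer_ge0 le_outer outer_sigma_subadditive.

(** * Approximable sets and Caratheodory measurability *)

(** A test set [Y] of finite outer measure has a cover by sets of finite measure
    whose total measure is nearly [mu Y]. Intersecting that cover with [E] and
    with its complement covers both halves of [Y], so the inequality for [Y] is
    the sum of the inequalities for the sets of the cover. *)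
Lemma caratheodory_finite_part E :
  (forall A, finite_part AA m A -> mu (A `&` E) + mu (A `\` E) <= m A) ->
  mu.-caratheodory E.
Proof.
move=> testE; apply: (@le_caratheodory_measurable _ _ mu) => Y /=.
have [->|] := eqVneq (mu Y) +oo; first exact: leey.
rewrite -ltey -ge0_fin_numE ?outer_ge0// => Yfin.
apply/lee_addgt0Pr => e e0.
have [|F [AAF YF Fe]] := @outer_cover Y (mu Y + e%:E).
  by rewrite lteDl ?lte_fin.
apply: le_trans (ltW Fe).
(* A term of a nonnegative series with finite sum is finite. *)
have Foo n : m (F n) < +oo.
  rewrite ltey; apply: contraPneq Fe => Fn; apply/negP.
  rewrite (eseries_pinfty _ _ Fn) ?ltNge ?leey// => k _.
  by rewrite -ltNye (lt_le_trans _ (m_ge0 _)).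
have traceE Z : mu (Y `&` Z) <= \sum_(n <oo) mu (F n `&` Z).
  apply: le_trans (outer_sigma_subadditive _).
  by apply: le_outer; rewrite -setI_bigcupl; exact: setSI.
apply: (le_trans (leeD (traceE E) (traceE (~` E)))).
rewrite -nneseriesD; [|by move=> *; exact: outer_ge0..].
apply: lee_nneseries => n *; first by rewrite adde_ge0 ?outer_ge0.
by rewrite -setDE; apply: testE; split.
Qed.

(** Both [A `&` E] and [A `\` E] differ from their counterparts for [B] only
    inside [A `&` (E `+` B)]; each of the two exchanges costs half of [e]. *)
Lemma approximable_caratheodory E :
  approximable AA m E -> mu.-caratheodory E.
Proof.
move=> apxE; apply: caratheodory_finite_part => A Afin.
have [AAA _] := Afin.
apply/lee_addgt0Pr => e e0.
have [B AAB dB] := apxE A Afin (e / 2)%R (divr_gt0 e0 (ltr0n _ 2)).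
have AEB : mu (A `&` E) <= m (A `&` B) + (e / 2)%:E.
  apply: le_trans (leeD (outer_le (AAI AAA AAB)) (ltW dB)).
  apply: le_trans (outer_measureU2 mu _ _); apply: le_outer => x [Ax Ex].
  by have [Bx|Bx] := pselect (B x); [left|right; split => //; left].
have ADEB : mu (A `\` E) <= m (A `\` B) + (e / 2)%:E.
  apply: le_trans (leeD (outer_le (AAD AAA AAB)) (ltW dB)).
  apply: le_trans (outer_measureU2 mu _ _); apply: le_outer => x [Ax Ex].
  by have [Bx|Bx] := pselect (B x); [right; split => //; right|left].
apply: (le_trans (leeD AEB ADEB)).
by rewrite addeACA m_additive// -EFinD -splitr.
Qed.

(** [A `&` (E `+` B)] is covered by the omitted tail of the cover ([defect]) and
    by the part outside [E] of the trace [W] of the whole cover on [A]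
    ([excess]); each contributes at most half of [e]. *)
Lemma caratheodory_approximable E :
  mu.-caratheodory E -> approximable AA m E.
Proof.
move=> carE A [AAA Aoo] e e0.
have e20 : (0 < e / 2)%R by rewrite divr_gt0.
have AEfin : mu (A `&` E) \is a fin_num.
  rewrite ge0_fin_numE ?outer_ge0//; apply: le_lt_trans Aoo.
  by apply: le_trans (outer_le AAA); apply: le_outer => x [].
have [|F [AAF AEF Fe]] := @outer_cover (A `&` E) (mu (A `&` E) + (e / 2)%:E).
  by rewrite lteDl ?lte_fin.
have Foo : \sum_(n <oo) m (F n) < +oo.
  by apply: lt_trans Fe _; rewrite ltey_eq fin_numD AEfin.
have [N tailN] : exists N, \sum_(N <= n <oo) m (F n) < (e / 2)%:E.
  have := @nneseries_tail_cvg _ _ xpredT Foo (fun n _ => m_ge0 (AAF n)).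
  have e2pos : 0 < (e / 2)%:E by rewrite lte_fin.
  move=> /(_ _ (open_ereal_lt' e2pos))[N _ tailN].
  by exists N; exact: (tailN N (leqnn N)).
exists (\bigcup_(n in `I_N) F n).
  by rewrite bigcup_mkord; elim/big_ind: _.
pose W := A `&` \bigcup_n F n.
(* [W `&` E] is [A `&` E], so Caratheodory's equation for [W] makes
   [mu (W `&` ~` E)] the gap between [mu W] and [mu (A `&` E)]; cancelling the
   latter requires it to be finite. *)
have excess : mu (W `&` ~` E) <= (e / 2)%:E.
  rewrite -(@leeD2lE _ (mu (A `&` E)))//; apply: le_trans (ltW Fe).
  have <- : W `&` E = A `&` E.
    rewrite /W setIAC; apply/setIidPl; exact: AEF.
  by rewrite -carE; apply: outer_le_series => // x [].
have defect : mu (\bigcup_(n in ~` `I_N) F n) < (e / 2)%:E.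
  apply: le_lt_trans tailN.
  apply: le_trans (outer_measure_sigma_subadditive_tail mu N F) _.
  by apply: lee_nneseries => n *; [exact: outer_ge0|exact: outer_le].
rewrite /dist_on (splitr e) EFinD.
apply: le_lt_trans (lte_leD _ defect excess); last first.
  by rewrite ge0_fin_numE ?outer_ge0// (le_lt_trans excess)// ltry.
apply: le_trans (outer_measureU2 mu _ _); apply: le_outer.
move=> x [Ax [[Ex NBx]|[[n nN Fnx] NEx]]].
- have [n _ Fnx] := AEF x (conj Ax Ex).
  by left; exists n => // nN; apply: NBx; exists n.
- by right; split => //; split => //; exists n.
Qed.

Lemma approximableE : approximable AA m = mu.-caratheodory.
Proof.
by apply/seteqP; split => E;
  [exact: approximable_caratheodory|exact: caratheodory_approximable].
Qed.

Lemma approximable_sigma_algebra : sigma_algebra setT (approximable AA m).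
Proof. by rewrite approximableE; exact: caratheodory_sigma_algebra. Qed.

Lemma outer_sigma_additive (E : nat -> set X) :
  (forall n, approximable AA m (E n)) -> trivIset setT E ->
  mu (\bigcup_n E n) = \sum_(n <oo) mu (E n).
Proof. by rewrite approximableE; exact: caratheodory_sigma_additive. Qed.

End outer.

Theorem theorem1p2 (R : realType) (X : Type) (AA : set (set X))
    (m : set X -> \bar R)
    (hAA : is_algebra AA) (hm : is_measure_on AA m) :
  sigma_algebra setT (approximable AA m) /\
  forall E : nat -> set X, (forall n, approximable AA m (E n)) ->
    trivIset setT E ->
    outer AA m (\bigcup_n E n) = \sum_(n <oo) outer AA m (E n).
Proof.
split; first exact: approximable_sigma_algebra.
exact: outer_sigma_additive.
Qed.
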